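(* Let $M\to N$ be an oriented matroid perspective on a linearly ordered set $E$. Let $A\subseteq E$ be any union of parts of the active partition of $M\to N$ (cyclic, acyclic or hybrid parts). Then the oriented matroid perspective $-_AM\to -_AN$ has the same active partition as $M\to N$, meaning precisely that it has the same cyclic parts, the same acyclic parts and the same hybrid part.
   Context: All ground sets are finite. Two signed sets are conformal if they have the same signs on the intersection of their supports. A vector (resp. covector) of an oriented matroid is a conformal union (composition) of circuits (resp. cocircuits). A signed set is positive if all its signs are positive; a positive signed set is identified with its support. An ordered pair $(M,N)$ of oriented matroids on the same ground set $E$ is an oriented matroid perspective, denoted $M\to N$, if every circuit of $M$ is a vector of $N$ (equivalently, every cocircuit of $N$ is a covector of $M$). For $A\subseteq E$, $-_AM$ denotes the oriented matroid obtained from $M$ by reorienting $A$, i.e. by reversing the signs of the elements of $A$ in all signed circuits and cocircuits; $-_AM\to -_AN$ is again an oriented matroid perspective. For an oriented matroid $M$ on a linearly ordered set $E$, let $$O(M)=\{\min(C)\mid C \text{ positive circuit of } M\},\qquad O^*(M)=\{\min(C)\mid C \text{ positive cocircuit of } M\}.$$ Let $M\to N$ be an oriented matroid perspective on a linearly ordered set $E$, with $O(M)=\{g_1<\dots<g_\varepsilon\}$ and $O^*(N)=\{h_1<\dots<h_\iota\}$. Define $G_\varepsilon=\emptyset$ and, for $0\le k\le \varepsilon-1$, $$G_k=\bigcup_{\substack{C\text{ positive circuit of }M\\ \min(C)\ge g_{k+1}}} C.$$ Define $H_\iota=E$ and, for $0\le k\le \iota-1$, $$H_k=E\setminus\bigcup_{\substack{C\text{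 positive cocircuit of }N\\ \min(C)\ge h_{k+1}}} C.$$ One has $\emptyset=G_\varepsilon\subset\dots\subset G_1\subset G_0\subseteq H_0\subset H_1\subset\dots\subset H_\iota=E$. The active partition of $M\to N$ is the partition $$E=(G_{\varepsilon-1}\setminus G_\varepsilon)\uplus\dots\uplus(G_0\setminus G_1)\uplus(H_0\setminus G_0)\uplus(H_1\setminus H_0)\uplus\dots\uplus(H_\iota\setminus H_{\iota-1}).$$ The parts $G_{k-1}\setminus G_k$ ($1\le k\le\varepsilon$), contained in $G_0$, are the cyclic parts; the parts $H_k\setminus H_{k-1}$ ($1\le k\le\iota$), contained in $E\setminus H_0$, are the acyclic parts; and $H_0\setminus G_0$ (possibly empty) is the hybrid part. The active partition is always considered as given together with the sets $G_0$ and $H_0$, i.e. together with the information of which parts are cyclic, acyclic and hybrid. *)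

(* Defs.v *)
From HB Require Import structures.
From mathcomp Require Import all_boot all_order.

Set Implicit Arguments.
Unset Strict Implicit.
Unset Printing Implicit Defensive.

Import Order.TTheory.
Local Open Scope order_scope.

(* A signed subset of E is the function sending e to [Some true] if e carries
   the sign +, to [Some false] if it carries the sign -, and to [None] if e is
   outside the support. *)
Notation signed_set E := {ffun E -> option bool}.

Section SignedSets.
Variable E : finType.
Implicit Types (X Y C : signed_set E) (A : {set E}) (F : {set signed_set E}).

Definition pos X : {set E} := [set e | X e == Some true].
Definition neg X : {set E} := [set e | X e == Some false].
Definition supp X : {set E} := pos X :|: neg X.
Definition positive X : bool := neg X == set0.

Definition reverse A X : signed_set E :=
  [ffun e => if e \in A then omap negb (X e) else X e].
Definition opp X : signed_set E := reverse setT X.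

Definition conformal X Y : bool :=
  [forall e in supp X :&: supp Y, X e == Y e].

Definition agreement X Y : {set E} :=
  (pos X :&: pos Y) :|: (neg X :&: neg Y).

(* The supports are disjoint, or the restrictions of X and Y to the
   intersection of their supports are neither equal nor opposite. *)
Definition orthogonal X Y : bool :=
  (agreement X Y == set0) == (agreement X (opp Y) == set0).

Definition conformal_union F X : bool :=
  [&& [forall C in F, forall D in F, conformal C D],
      pos X == \bigcup_(C in F) pos C
    & neg X == \bigcup_(C in F) neg C].

End SignedSets.

(* Oriented matroids given by their signed circuits. *)
Record oriented_matroid (E : finType) := OrientedMatroid {
  circuits : {set signed_set E};
  circuit_neq0 : forall X, X \in circuits -> supp X != set0;
  circuit_opp : forall X, X \in circuits -> opp X \in circuits;
  circuit_incomparable : forall X Y, X \in circuits -> Y \in circuits ->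
    supp X \subset supp Y -> X = Y \/ X = opp Y;
  circuit_elimination : forall X Y e, X \in circuits -> Y \in circuits ->
    X <> opp Y -> e \in pos X :&: neg Y ->
    exists2 Z, Z \in circuits &
      pos Z \subset (pos X :|: pos Y) :\ e /\
      neg Z \subset (neg X :|: neg Y) :\ e
}.

Section OrientedMatroids.
Variable E : finType.
Implicit Types (M N : oriented_matroid E) (X Y Z : signed_set E) (A : {set E}).

(* The signed circuits of the dual oriented matroid: the support-minimal
   elements among the nonempty signed sets orthogonal to all circuits. *)
Definition circuit_orthogonal M Y : bool :=
  (supp Y != set0) && [forall C in circuits M, orthogonal C Y].

Definition cocircuits M : {set signed_set E} :=
  [set Y | circuit_orthogonal M Y &
    [forall Z, circuit_orthogonal M Z ==> ~~ (supp Z \proper supp Y)]].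

Definition vectors M : {set signed_set E} :=
  [set X | [exists F : {set signed_set E},
    (F \subset circuits M) && conformal_union F X]].

Definition perspective M N : Prop :=
  forall C, C \in circuits M -> C \in vectors N.

Lemma reverseK A : involutive (@reverse E A).
Proof.
move=> X; apply/ffunP=> e; rewrite !ffunE.
by case: (e \in A); case: (X e) => [[]|].
Qed.

Lemma supp_reverse A X : supp (reverse A X) = supp X.
Proof.
apply/setP=> e; rewrite !inE !ffunE.
by case: (e \in A); case: (X e) => [[]|].
Qed.

Lemma opp_reverse A X : opp (reverse A X) = reverse A (opp X).
Proof. by apply/ffunP=> e; rewrite !ffunE !inE; case: ifP. Qed.

Lemma agreement_reverse A X Y :
  agreement (reverse A X) (reverse A Y) = agreement X Y.
Proof.
apply/setP=> e; rewrite !inE !ffunE; case: ifP => // _.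
by case: (X e) => [[]|]; case: (Y e) => [[]|].
Qed.

Lemma orthogonal_reverse A X Y :
  orthogonal (reverse A X) (reverse A Y) = orthogonal X Y.
Proof. by rewrite /orthogonal opp_reverse !agreement_reverse. Qed.

Section Reorientation.
Variables (A : {set E}) (M : oriented_matroid E).

Let C := [set reverse A X | X in circuits M].

Lemma mem_reorient X : (X \in C) = (reverse A X \in circuits M).
Proof.
by rewrite -{1}[X](reverseK A) mem_imset //; apply: inv_inj; apply: reverseK.
Qed.

Lemma reorient_neq0 X : X \in C -> supp X != set0.
Proof. by rewrite mem_reorient => /circuit_neq0; rewrite supp_reverse. Qed.

Lemma reorient_opp X : X \in C -> opp X \in C.
Proof. by rewrite !mem_reorient -opp_reverse; apply: circuit_opp. Qed.

Lemma reorient_incomparable X Y : X \in C -> Y \in C ->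
  supp X \subset supp Y -> X = Y \/ X = opp Y.
Proof.
rewrite !mem_reorient => XM YM; rewrite -(supp_reverse A X) -(supp_reverse A Y).
move=> /(circuit_incomparable XM YM); rewrite opp_reverse.
by case=> /(inv_inj (reverseK A)); [left | right].
Qed.

Lemma reorient_elimination X Y e : X \in C -> Y \in C ->
  X <> opp Y -> e \in pos X :&: neg Y ->
  exists2 Z, Z \in C &
    pos Z \subset (pos X :|: pos Y) :\ e /\
    neg Z \subset (neg X :|: neg Y) :\ e.
Proof.
rewrite !mem_reorient => XM YM XY eXY.
suff [Z ZM [Zp Zn]] : exists2 Z, Z \in circuits M &
    pos Z \subset (pos (reverse A X) :|: pos (reverse A Y)) :\ e /\
    neg Z \subset (neg (reverse A X) :|: neg (reverse A Y)) :\ e.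
  exists (reverse A Z); first by rewrite mem_reorient reverseK.
  split; apply/subsetP=> f; move/subsetP/(_ f): Zp; move/subsetP/(_ f): Zn;
    rewrite !inE !ffunE; case: (f \in A); case: (Z f) => [[]|] //=;
    case: (X f) => [[]|]; case: (Y f) => [[]|] //=;
    by case: (f == e) => //= h1 h2 _; rewrite ?h1 ?h2.
have XY' : reverse A X <> opp (reverse A Y).
  by rewrite opp_reverse => /(inv_inj (reverseK A)).
have [eA|eA] := boolP (e \in A).
  have YX' : reverse A Y <> opp (reverse A X).
    by move=> h; apply: XY'; rewrite h /opp reverseK.
  have [|Z ZM Zpn] := circuit_elimination YM XM YX' (e := e).
    by move: eXY; rewrite !inE !ffunE eA => /andP[/eqP-> /eqP->].
  by exists Z; rewrite // setUC [neg _ :|: _]setUC.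
apply: circuit_elimination => //.
by move: eXY; rewrite !inE !ffunE (negPf eA).
Qed.

Definition reorient : oriented_matroid E :=
  OrientedMatroid reorient_neq0 reorient_opp reorient_incomparable
    reorient_elimination.

End Reorientation.

Lemma cocircuits_reorient A M :
  cocircuits (reorient A M) = [set reverse A Y | Y in cocircuits M].
Proof.
have orthE Y : circuit_orthogonal (reorient A M) Y =
    circuit_orthogonal M (reverse A Y).
  rewrite /circuit_orthogonal supp_reverse; congr (_ && _).
  apply/forall_inP/forall_inP=> h X XM.
    rewrite -(orthogonal_reverse A) reverseK; apply: h.
    by rewrite mem_reorient reverseK.
  by rewrite -(orthogonal_reverse A); apply: h; rewrite -mem_reorient.
apply/setP=> Y; rewrite -{2}[Y](reverseK A).
rewrite (mem_imset _ _ (inv_inj (reverseK A))) !inE orthE; congr (_ && _).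
apply/forall_inP/forall_inP=> h Z ZM.
  by rewrite supp_reverse -(supp_reverse A Z); apply: h; rewrite orthE reverseK.
by rewrite -(supp_reverse A Z) -(supp_reverse A Y); apply: h; rewrite -orthE.
Qed.

End OrientedMatroids.

Section ActivePartition.
Variables (d : Order.disp_t) (E : finOrderType d).
Implicit Types (M N : oriented_matroid E) (B : {set E}).

Definition is_min B (m : E) : bool := (m \in B) && [forall e in B, m <= e].

Definition positive_circuits M : {set {set E}} :=
  [set supp C | C in circuits M & positive C].
Definition positive_cocircuits M : {set {set E}} :=
  [set supp C | C in cocircuits M & positive C].

Definition active_elements M : {set E} :=
  [set g | [exists B in positive_circuits M, is_min B g]].
Definition dual_active_elements M : {set E} :=
  [set h | [exists B in positive_cocircuits M, is_min B h]].

(* In 0-based indexing, the entry of index k of the increasing enumeration of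
   [active_elements M], which is O(M), is g_(k+1); [onth] returns [None] past
   the last entry, so that [flagG M k] is G_k for all k, including the last one.
   Likewise for [dual_active_elements N], which is O^*(N), and H_k. *)
Definition increasing B : seq E := sort <=%O (enum B).

Definition flagG M (k : nat) : {set E} :=
  if onth (increasing (active_elements M)) k is Some g then
    \bigcup_(B in positive_circuits M | [exists m, is_min B m && (g <= m)]) B
  else set0.

Definition flagH N (k : nat) : {set E} :=
  if onth (increasing (dual_active_elements N)) k is Some h then
    ~: \bigcup_(B in positive_cocircuits N |
                 [exists m, is_min B m && (h <= m)]) B
  else setT.

Definition cyclic_parts M : {set {set E}} :=
  [set flagG M k :\: flagG M k.+1 | k : 'I_#|active_elements M|].
Definition acyclic_parts N : {set {set E}} :=
  [set flagH N k.+1 :\: flagH N k | k : 'I_#|dual_active_elements N|].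
Definition hybrid_part M N : {set E} := flagH N 0 :\: flagG M 0.

(* The hybrid part is listed even when it is empty. *)
Definition active_partition M N : {set {set E}} :=
  cyclic_parts M :|: [set hybrid_part M N] :|: acyclic_parts N.

End ActivePartition.

(* Main.v *)
Require Import Defs.
From mathcomp Require Import all_boot all_order.

(** For a threshold [t], let [cycle_span M t] be the union of the positive
    circuits of [M] all of whose elements are at least [t], and let
    [cocycle_span N t] be the analogous union of positive cocircuits of [N].
    An element [g] is active exactly when it lies in [cycle_span M (Some g)],
    and every G_k is such a span, every H_k the complement of some
    [cocycle_span N t].  So the active partition is determined by these two
    functions of [t], and it is enough to show that reorienting a union of parts
    leaves both unchanged.

    Every part is the difference of two nested flag members, and parts are
    disjoint, so a union of parts is a symmetric difference of flag members.
    Reorienting a symmetric difference amounts to reorienting successively, and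
    a reorientation that preserves the spans preserves the flag members: hence
    one may assume that [A] is a single flag member
    ([span_preserving_symdiff], [union_of_parts_preserving]).  Reorienting the
    complement of [A] gives the same positive circuits and cocircuits as
    reorienting [A], which leaves the case where [A] is one span.

    Let [A] be a span of positive circuits.  Positive cocircuits of [N] avoid
    positive circuits of [M], so they avoid [A] and are not affected.  Positive
    circuits inside [A] become negative, and their opposites are positive.  A
    circuit that becomes positive by the reorientation had its negative elements
    in [A]; as [A] is a union of positive circuits, those elements can be
    eliminated while any prescribed element outside [A] is kept
    ([circuits_absorbing]).  Hence, for a threshold below that of [A], an element
    outside [A] is in the span after the reorientation exactly when it was
    before, and the elements of [A] are in both spans.  For a threshold above
    that of [A], the span lies inside [A], where the reorientation exchanges
    positive circuits with their opposites ([span_reverse]).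

    The same argument for a span of positive cocircuits needs the dual
    elimination property, although cocircuits are given only as minimal
    signed sets orthogonal to all circuits.  It is obtained from strong circuit
    elimination ([strong_elimination]), through a Farkas alternative between
    circuits and orthogonal signed sets ([farkas]), which implies that a positive
    signed set orthogonal to all circuits is a union of positive cocircuits
    ([positive_cocircuit]). *)

Set Implicit Arguments.
Unset Strict Implicit.
Unset Printing Implicit Defensive.

Import Order.TTheory.

(** * Strong circuit elimination *)

Section Elimination.
Variables (E : finType) (M : oriented_matroid E).
Implicit Types (X Y Z W : signed_set E) (e f g h : E).

Lemma in_supp X e : (e \in supp X) = (X e != None).
Proof. by rewrite !inE; case: (X e) => [[]|]. Qed.

Lemma oppE X e : opp X e = omap negb (X e).
Proof. by rewrite ffunE inE. Qed.

Lemma in_agreement X Y e : (e \in agreement X Y) = (X e == Y e) && (Y e != None).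
Proof. by rewrite !inE; case: (X e) (Y e) => [[]|] [[]|]. Qed.

(** The elimination axiom takes [X] positive and [Y] negative at [e]; in the
    other case [X] and [Y] are exchanged. *)
Lemma weak_elimination X Y e :
    X \in circuits M -> Y \in circuits M -> X <> opp Y ->
    e \in agreement X (opp Y) ->
  exists2 Z, Z \in circuits M &
    Z e = None /\ forall h, Z h \in [:: None; X h; Y h].
Proof.
have main X' Y' : X' \in circuits M -> Y' \in circuits M -> X' <> opp Y' ->
    e \in pos X' :&: neg Y' ->
  exists2 Z, Z \in circuits M &
    Z e = None /\ forall h, Z h \in [:: None; X' h; Y' h].
  move=> XM YM XY eXY; have [Z ZM [Zp Zn]] := circuit_elimination XM YM XY eXY.
  exists Z => //; split=> [|h].
    move/subsetP/(_ e): Zp; move/subsetP/(_ e): Zn; rewrite !inE eqxx.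
    by case: (Z e) => [[]|] // h1 h2; [have := h2 erefl | have := h1 erefl].
  move/subsetP/(_ h): Zp; move/subsetP/(_ h): Zn; rewrite !inE.
  case: (Z h) => [[]|] // h1 h2; [move: (h2 erefl) | move: (h1 erefl)];
    by case/andP=> _ /orP[] /eqP->; rewrite eqxx ?orbT.
move=> XM YM XY; rewrite in_agreement oppE => eXY.
have [eX|eX] := boolP (e \in pos X).
  by apply: main => //; move: eXY eX; rewrite !inE; case: (X e) (Y e) => [[]|] [[]|].
have [||Z ZM [Ze Zh]] := main Y X YM XM.
- by move=> YX; apply: XY; rewrite YX /opp reverseK.
- by move: eXY eX; rewrite !inE; case: (X e) (Y e) => [[]|] [[]|].
exists Z => //; split=> // h; have := Zh h.
by rewrite !inE orbCA [_ || (Z h == Y h)]orbC orbCA.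
Qed.

(** Let [Z] come from weak elimination and suppose that it has lost [f].  By
    incomparability it has an element [g] outside [X], where it agrees with [Y].
    Eliminating [g] between [Y] and [opp Z] gives [Y'] that still contains [e],
    and the supports of [X] and [Y'] miss [g], so that by induction [e] can be
    eliminated between them while [f] is kept.  The result [W] has correct
    signs except where it disagrees with [Z]; these places are removed by
    eliminations with [Z] itself, which keep [f] since [f] is not in [Z].

    The measure counts the elements of the union twice, so that the elimination
    between [Y] and [opp Z] is also covered when [f] is in [Y]: there the union
    need not shrink, but the element to keep, [e], lies in only one of the two
    circuits. *)
Lemma strong_elimination X Y e f :
    X \in circuits M -> Y \in circuits M -> e \in agreement X (opp Y) ->
    X f != None -> Y f \in [:: None; X f] ->
  exists2 Z, Z \in circuits M &
    [/\ Z e = None, Z f = X f & forall h, Z h \in [:: None; X h; Y h]].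
Proof.
have [n] := ubnP (#|supp X :|: supp Y|.*2 + (Y f != None)).
elim: n X Y e f => // n IHn X Y e f; rewrite ltnS => len XM YM.
rewrite in_agreement oppE => eXY Xf Yf.
have IHS X' Y' e' f' : supp X' :|: supp Y' \proper supp X :|: supp Y ->
    X' \in circuits M -> Y' \in circuits M -> e' \in agreement X' (opp Y') ->
    X' f' != None -> Y' f' \in [:: None; X' f'] ->
    exists2 Z, Z \in circuits M &
    [/\ Z e' = None, Z f' = X' f' & forall h, Z h \in [:: None; X' h; Y' h]].
  move=> /proper_card lt *; apply: IHn => //; apply: leq_trans len.
  apply: leq_trans (leq_addr _ _); move: lt; rewrite -leq_double doubleS.
  by apply: leq_trans; rewrite ltnS -addn1 leq_add2l leq_b1.
have XY : X <> opp Y.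
  move=> XY; move: Xf Yf; rewrite XY oppE !inE.
  by case: (Y f) => [[]|].
have [|Z ZM [Ze Zs]] := weak_elimination XM YM XY (e := e).
  by rewrite in_agreement oppE.
have [Zf|Zf] := eqVneq (Z f) None; last first.
  exists Z => //; split=> //; move: (Zs f) Yf Zf; rewrite !inE.
  by case/or3P=> /eqP -> //; case/orP => /eqP->.
have [g gZ gX] : exists2 g, g \in supp Z & g \notin supp X.
  apply/subsetPn/negP => /(circuit_incomparable ZM XM) [] ZX; move: Ze eXY;
    by rewrite ZX ?oppE; case: (X e) (Y e) => [[]|] [[]|].
move: gZ gX; rewrite !in_supp negbK => gZ /eqP gX.
have ZgY : Z g = Y g.
  by move: (Zs g) gZ; rewrite gX !inE; case/or3P=> /eqP->.
have sZ : supp Z \subset supp X :|: supp Y.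
  apply/subsetP=> h; rewrite !(in_supp, in_setU); move: (Zs h); rewrite !inE.
  by case/or3P=> /eqP->; rewrite // => ->; rewrite ?orbT.
have [Y' Y'M [Y'g Y'e Y's]] : exists2 Y', Y' \in circuits M &
    [/\ Y' g = None, Y' e = Y e & forall h, Y' h \in [:: None; Y h; opp Z h]].
  apply: IHn; rewrite ?circuit_opp ?in_agreement ?oppE ?Ze //; last 2 first.
  - by move: gZ; rewrite ZgY; case: (Y g) => [[]|].
  - by move: eXY; case: (X e) (Y e) => [[]|] [[]|].
  apply: leq_trans len; rewrite addn0 supp_reverse.
  have sU : supp Y :|: supp Z \subset supp X :|: supp Y.
    by rewrite subUset subsetUr sZ.
  have [Yf0|Yf0] := eqVneq (Y f) None; last first.
    by rewrite addn1 ltnS leq_double subset_leq_card.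
  rewrite addn0 ltn_double proper_card // properE sU /=.
  apply/subsetPn; exists f; first by rewrite !(in_supp, in_setU) ?Xf.
  by rewrite !(in_supp, in_setU) Zf Yf0.
have Y'S : supp Y' \subset supp X :|: supp Y.
  apply/subsetP=> h; move/subsetP/(_ h): sZ; rewrite !(in_supp, in_setU).
  move: (Y's h); rewrite !inE oppE; case/or3P=> /eqP->; rewrite ?orbT //.
    by move=> _ ->; rewrite orbT.
  by case: (Z h) => [z|] //= ->.
have [W0 W0M [W0e W0f W0s]] : exists2 W, W \in circuits M &
    [/\ W e = None, W f = X f & forall h, W h \in [:: None; X h; Y' h]].
  apply: IHS => //; last 2 first.
  - by rewrite in_agreement oppE Y'e.
  - move: (Y's f); rewrite !inE oppE Zf /= => /or3P[] /eqP-> //.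
    by move: Yf; rewrite !inE.
  rewrite properE subUset subsetUl Y'S; apply/subsetPn; exists g.
    by rewrite !(in_supp, in_setU) -ZgY gZ orbT.
  by rewrite !(in_supp, in_setU) gX Y'g.
(* Among the circuits with the right behaviour at e and f, and whose signs are
   wrong only where they are opposite to Z, one disagreeing least with Z. *)
pose ok W := [&& W \in circuits M, W e == None, W f == X f &
  [forall h, W h \in [:: None; X h; Y h; opp Z h]]].
have okW0 : ok W0.
  apply/and4P; split; rewrite ?W0e ?W0f //; apply/forallP=> h.
  move: (W0s h) (Y's h); rewrite !inE => /or3P[] /eqP-> //; rewrite ?eqxx ?orbT //.
  by case/or3P=> ->; rewrite ?orbT.
case: (arg_minnP (fun W => #|agreement W (opp Z)|) okW0) => W.
case/and4P=> WM /eqP We /eqP Wf /forallP Ws Wmin.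
have [W0'|[h hW]] := set_0Vmem (agreement W (opp Z)).
  exists W => //; split=> // h; move: (Ws h) (in_set0 h).
  rewrite -W0' in_agreement oppE !inE.
  by case/or4P=> /eqP->; rewrite ?eqxx ?orbT //; case: (Z h).
have [|||W' W'M [W'h W'f W's]] := IHS W Z h f _ WM ZM hW; rewrite ?Wf ?Zf //.
  rewrite properE subUset sZ andbT; apply/andP; split.
    apply/subsetP=> k; move/subsetP/(_ k): sZ; rewrite !(in_supp, in_setU).
    move: (Ws k); rewrite !inE oppE; case/or4P=> /eqP->; rewrite ?orbT //.
    - by move=> _ ->.
    - by move=> _ ->; rewrite orbT.
    by case: (Z k) => [z|] //= ->.
  apply/subsetPn; exists e.
    by move: eXY; rewrite !(in_supp, in_setU); case: (X e) (Y e) => [[]|] [[]|].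
  by rewrite !(in_supp, in_setU) We Ze.
have /Wmin : ok W'.
  apply/and4P; split; rewrite ?W'f ?Wf //.
    by move: (W's e); rewrite !inE We Ze !orbb.
  apply/forallP=> k; move: (W's k) (Ws k) (Zs k); rewrite !inE.
  case/or3P=> /eqP-> //; rewrite ?eqxx // => _.
  by case/or3P=> ->; rewrite ?orbT.
rewrite leqNgt proper_card // properE; apply/andP; split.
  apply/subsetP=> k; rewrite !in_agreement oppE; move: (W's k); rewrite !inE.
  by case/or3P=> /eqP->; case: (Z k) => [[]|].
by apply/subsetPn; exists h => //; rewrite in_agreement W'h oppE;
  case: (Z h) => [[]|].
Qed.

End Elimination.

(** * Farkas alternative for circuits and orthogonal signed sets *)

Section Duality.
Variables (E : finType) (M : oriented_matroid E).
Implicit Types (X Y Z W C D : signed_set E) (e f g h : E) (F G T : {set E}).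

(** Negative elements of [C] in [G] but not in [F] are eliminated one by one
    with the circuits [D]; these do not contain [e], so strong elimination keeps
    it, and they bring no new negative element outside [F]. *)
Lemma absorption F G : F \subset G ->
    (forall j, j \in G :\: F -> exists2 D, D \in circuits M &
       [/\ j \in pos D, neg D \subset F & supp D \subset G]) ->
  forall C e, C \in circuits M -> neg C \subset G -> e \in pos C :\: G ->
  exists2 Z, Z \in circuits M &
    [/\ e \in pos Z, neg Z \subset F & supp Z \subset supp C :|: G].
Proof.
move=> FG GD C e CM CG; rewrite in_setD => /andP[eG eC].
pose ok Z := [&& Z \in circuits M, e \in pos Z, neg Z \subset G
                & supp Z \subset supp C :|: G].
have okC : ok C by rewrite /ok CM eC CG subsetUl.
case: (arg_minnP (fun Z => #|neg Z :\: F|) okC) => Z.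
case/and4P=> ZM eZ ZG ZCG Zmin; exists Z => //; split=> //.
rewrite -setD_eq0; apply/set0Pn=> -[j]; rewrite in_setD => /andP[jF jZ].
have jG := subsetP ZG j jZ.
have [|D DM [jD DF DG]] := GD j; first by rewrite in_setD jF.
have De : D e = None.
  by apply/eqP; rewrite -[_ == _]negbK -in_supp; apply: contra eG; apply: subsetP.
have [|||Z' Z'M [Z'j Z'e Z's]] := @strong_elimination _ M Z D j e ZM DM.
- by move: jZ jD; rewrite in_agreement oppE !inE => /eqP-> /eqP->.
- by move: eZ; rewrite inE => /eqP->.
- by rewrite De.
have /Zmin : ok Z'.
  rewrite /ok Z'M /=; apply/and3P; split; first by move: eZ; rewrite !inE Z'e.
    apply/subsetP=> h; move: (Z's h); rewrite !inE => /or3P[] /eqP-> // hN.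
      by apply: (subsetP ZG); rewrite inE.
    by apply/(subsetP FG)/(subsetP DF); rewrite inE.
  apply/subsetP=> h; rewrite in_supp => hN.
  have : h \in supp Z :|: supp D.
    by move: (Z's h) hN; rewrite in_setU !in_supp !inE => /or3P[] /eqP-> // ->;
      rewrite ?orbT.
  by case/setUP; [apply: subsetP | rewrite in_setU orbC => /(subsetP DG)->].
rewrite leqNgt proper_card // properE; apply/andP; split.
  apply/subsetP=> h; rewrite !in_setD => /andP[hF]; rewrite hF.
  move: (Z's h); rewrite !inE => /or3P[] /eqP-> // hN.
  by case/negP: hF; apply: (subsetP DF); rewrite inE.
by apply/subsetPn; exists j; rewrite in_setD ?jF // inE Z'j andbF.
Qed.

(** Orthogonality, to the circuits of the deletion of [T], of the restriction of
    [Y] to the complement of [T]. *)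
Definition orthogonal_off T Y : bool :=
  [forall X in circuits M, [disjoint supp X & T] ==> orthogonal X Y].

(** Circuits come in opposite pairs, so a failure of orthogonality can be
    witnessed by a circuit that agrees with [Y] somewhere and is nowhere opposite
    to it. *)
Lemma not_orthogonal X Y : X \in circuits M -> ~~ orthogonal X Y ->
  exists2 X', X' \in circuits M &
    [/\ supp X' = supp X, exists f, f \in agreement X' Y
      & agreement X' (opp Y) = set0].
Proof.
move=> XM; rewrite /orthogonal.
have [XY|[f fXY]] := set_0Vmem (agreement X Y).
  rewrite XY eqxx eq_sym eqb_id => /set0Pn[f fXY].
  exists (opp X); rewrite ?circuit_opp //; split; first exact: supp_reverse.
    exists f; move: fXY; rewrite !in_agreement !oppE.
    by case: (X f) (Y f) => [[]|] [[]|].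
  by rewrite /opp agreement_reverse.
have -> : (agreement X Y == set0) = false by apply/negbTE/set0Pn; exists f.
by rewrite eq_sym eqbF_neg negbK => /eqP XY; exists X => //; split=> //; exists f.
Qed.

(** If 0 is not a possible value at [z], there is a circuit [X1] which
    agrees with [Y] wherever they meet, and it forces the value opposite to
    [X1 z].  If this value fails as well, because of [X2], eliminating [z] between
    [X1] and [X2] yields a circuit avoiding [z] that contradicts the assumption on
    [Y]. *)
Lemma extend_orthogonal T z Y :
    Y z = None -> orthogonal_off (z |: T) Y ->
  exists Y', orthogonal_off T Y' /\ forall h, h != z -> Y' h = Y h.
Proof.
move=> Yz /forall_inP Yo.
have [?|] := boolP (orthogonal_off T Y); first by exists Y.
case/forall_inPn=> X XM; rewrite negb_imply => /andP[XT].
case/(not_orthogonal XM) => X1 X1M [X1T [f fX1] X1o]; rewrite -X1T in XT.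
have stop Z : Z \in circuits M -> [disjoint supp Z & T] -> Z z = None ->
    forall g, g \in agreement Z Y -> agreement Z (opp Y) = set0 -> False.
  move=> ZM ZT Zz g gZ Zo; have := Yo Z ZM; rewrite disjoint_sym.
  rewrite disjoints_subset subUset sub1set in_setC in_supp Zz /=.
  rewrite -disjoints_subset disjoint_sym ZT /orthogonal Zo eqxx /=.
  by rewrite eqb_id => /eqP E0; rewrite E0 inE in gZ.
exists [ffun x => if x == z then omap negb (X1 z) else Y x]; split; last first.
  by move=> h; rewrite ffunE => /negbTE->.
set Y' := finfun _.
have Y'z : Y' z = omap negb (X1 z) by rewrite ffunE eqxx.
have Y'E h : h != z -> Y' h = Y h by rewrite ffunE => /negbTE->.
apply/forall_inP=> X2' X2'M; apply/implyP=> X2'T; apply/negPn/negP.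
case/(not_orthogonal X2'M) => X2 X2M [X2T [f2 f2X2] X2o]; rewrite -X2T in X2'T.
have noY h : X2 h = opp Y h -> Y h = None.
  move=> hE; apply/eqP/negPn/negP=> hN; have := in_set0 h.
  have hz : h != z by apply: contraNneq hN => ->; rewrite Yz.
  by rewrite -X2o in_agreement !oppE Y'E // hE oppE eqxx; case: (Y h) hN.
have noY1 h : X1 h = opp Y h -> Y h = None.
  move=> hE; apply/eqP/negPn/negP=> hN; have := in_set0 h.
  by rewrite -X1o in_agreement hE !oppE eqxx; case: (Y h) hN.
have X1z : X1 z != None by apply/eqP=> X1z; apply: (stop X1 _ _ X1z f).
have X2z : X2 z != None.
  apply/eqP=> X2z; apply: (stop X2 _ _ X2z f2) => //.
    move: f2X2; rewrite !in_agreement; have [->|f2z] := eqVneq f2 z.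
      by rewrite X2z Y'z; case: (X1 z) X1z.
    by rewrite Y'E.
  apply/setP=> h; rewrite in_agreement inE; apply/negbTE/negP=> /andP[/eqP].
  by move/noY; rewrite oppE => ->.
have X12 : z \in agreement X1 (opp X2).
  have := in_set0 z; rewrite -X2o !in_agreement !oppE Y'z.
  by case: (X1 z) (X2 z) X1z X2z => [[]|] [[]|].
have [||Z ZM [Zz Zf Zs]] := strong_elimination X1M X2M X12 (f := f).
- by move: fX1; rewrite in_agreement => /andP[/eqP->].
- move: fX1 (noY f); rewrite in_agreement oppE => /andP[/eqP-> fN].
  by rewrite !inE; case: (Y f) (X2 f) fN => [[]|] [[]|] // _ /(_ erefl).
apply: (stop Z ZM _ Zz f).
- rewrite disjoint_subset; apply/subsetP=> h; rewrite in_supp !inE.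
  move: (Zs h); rewrite !inE => /or3P[] /eqP-> // hN.
    by rewrite (disjointFr XT) ?in_supp.
  by rewrite (disjointFr X2'T) ?in_supp.
- by move: fX1; rewrite !in_agreement Zf.
apply/setP=> h; rewrite in_agreement inE; apply/negbTE/negP=> /andP[/eqP Zh].
rewrite oppE => hN; move: (Zs h); rewrite !inE => /or3P[] /eqP E1.
- by move: hN; rewrite -oppE -Zh E1.
- by have := noY1 h; rewrite -Zh E1 => /(_ erefl) hY; rewrite hY in hN.
by have := noY h; rewrite -Zh E1 => /(_ erefl) hY; rewrite hY in hN.
Qed.

(** In the deletion of [T] and contraction of [F], either [e] lies in a positive
    circuit or it lies in a positive orthogonal signed set.  For the latter, the
    positive signed set [Y] whose support consists of the elements outside [F],
    [T] and these positive circuits is orthogonal to the circuits avoiding [T],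
    as [absorption] shows; its values on [T] are then found one element at a
    time with [extend_orthogonal]. *)
Lemma farkas F T e : [disjoint F & T] -> e \notin F -> e \notin T ->
    (forall X, X \in circuits M -> [disjoint supp X & T] -> e \in pos X ->
       ~~ (neg X \subset F)) ->
  exists Y, [/\ circuit_orthogonal M Y, e \in pos Y, [disjoint supp Y & F]
              & neg Y \subset T].
Proof.
move=> FT eF eT noX.
pose ok (S : {set E}) := (S \subset T) &&
  [exists Y, [&& orthogonal_off S Y, e \in pos Y, [disjoint supp Y & F :|: S]
     & neg Y \subset T]].
have okT : ok T.
  rewrite /ok subxx; pose c X := [&& X \in circuits M, [disjoint supp X & T] &
    neg X \subset F].
  pose G := F :|: \bigcup_(X | c X) supp X.
  have GT : [disjoint G & T].
    rewrite disjoints_subset subUset -disjoints_subset FT; apply/bigcupsP=> X.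
    by case/and3P; rewrite disjoints_subset.
  have eG : e \notin G.
    rewrite in_setU (negPf eF) /=; apply/bigcupP=> -[X /and3P[XM XT XF]].
    rewrite in_setU => /orP[eX|eX]; last by rewrite (subsetP XF) in eF.
    by have := noX X XM XT eX; rewrite XF.
  pose Y : signed_set E := [ffun h => if h \in G :|: T then None else Some true].
  have negY h : h \in neg Y = false by rewrite inE ffunE; case: ifP.
  apply/existsP; exists Y; apply/and4P; split.
  - apply/forall_inP=> X' X'M; apply/implyP=> X'T; apply/negPn/negP.
    case/(not_orthogonal X'M) => X XM [XT [f fX] Xo]; rewrite -XT in X'T.
    have XG : neg X \subset G.
      apply/subsetP=> h hX; have := in_set0 h; rewrite -Xo in_agreement oppE ffunE.
      rewrite in_setU; have -> : h \in T = false.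
        by apply: (disjointFr X'T); rewrite in_setU hX orbT.
      by move: hX; rewrite inE => /eqP->; case: (h \in G).
    have [|j||Z ZM [fZ ZF ZS]] := @absorption F G _ _ X f XM XG.
    + exact: subsetUl.
    + rewrite in_setD in_setU; case: (boolP (j \in F)) => //= jF.
      case/bigcupP=> D /and3P[DM DT DF]; rewrite in_setU => /orP[jD|jD].
        exists D => //; split=> //; apply: (subset_trans _ (subsetUr _ _)).
        by apply: bigcup_sup; apply/and3P.
      by rewrite (subsetP DF) in jF.
    + move: fX; rewrite in_agreement ffunE [f \in G :|: T]in_setU in_setD.
      case: (f \in G); case: (f \in T); rewrite /= ?andbF // => /andP[/eqP fX _].
      by rewrite inE fX.
    have ZT : [disjoint supp Z & T].
      rewrite disjoints_subset (subset_trans ZS) // subUset -!disjoints_subset.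
      by rewrite X'T.
    have fG : f \in G.
      rewrite in_setU; apply/orP; right; apply/bigcupP; exists Z.
        by apply/and3P.
      by rewrite in_setU fZ.
    by move: fX; rewrite in_agreement ffunE in_setU fG andbF.
  - by rewrite inE ffunE in_setU (negPf eG) (negPf eT).
  - rewrite disjoints_subset; apply/subsetP=> h; rewrite in_supp ffunE in_setC.
    by rewrite !in_setU; case: (h \in F); case: (h \in T); rewrite ?orbT.
  - by apply/subsetP=> h; rewrite negY.
(* A minimal set of elements that remain deleted must be empty. *)
case: (arg_minnP (fun S : {set E} => #|S|) okT) => S /andP[ST /existsP[Y]].
case/and4P=> Yo eY YFS YT Smin.
have [S0|[z zS]] := set_0Vmem S.
  exists Y; split=> //; last by rewrite S0 setU0 in YFS.
  apply/andP; split; first by apply/set0Pn; exists e; rewrite inE eY.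
  apply/forall_inP=> X XM; move/forall_inP/(_ X XM)/implyP: Yo; apply.
  by rewrite S0 disjoints_subset setC0 subsetT.
have zT := subsetP ST z zS.
have [||Y' [Y'o Y'E]] := @extend_orthogonal (S :\ z) z Y _ _.
- apply/eqP; rewrite -[_ == _]negbK -in_supp; apply: contraL zS => zY.
  by apply: contraFN (disjointFr YFS zY) => zS; rewrite in_setU zS orbT.
- by rewrite setD1K.
have /Smin : ok (S :\ z).
  apply/andP; split; first by rewrite (subset_trans _ ST) ?subsetDl.
  apply/existsP; exists Y'; apply/and4P; split=> //.
  - by move: eY; rewrite !inE Y'E //; apply: contraNneq eT => ->.
  - rewrite disjoints_subset; apply/subsetP=> h; rewrite in_supp.
    have [->|hz] := eqVneq h z.
      rewrite in_setC in_setU in_setD1 eqxx orbF => _.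
      by apply: contraL zT => zF; rewrite (disjointFr FT).
    rewrite Y'E // -in_supp => hY; rewrite in_setC in_setU in_setD1 hz /= -in_setU.
    by rewrite (disjointFr YFS).
  - apply/subsetP=> h; have [->//|hz] := eqVneq h z.
    by rewrite inE Y'E // => hY; apply: (subsetP YT); rewrite inE.
by rewrite leqNgt proper_card // properD1.
Qed.

End Duality.

(** * Positive cocircuits inside positive orthogonal sets *)

Section PositiveCocircuits.
Variables (E : finType) (M : oriented_matroid E).
Implicit Types (X Y Z U W C D : signed_set E) (e f g h : E).

Lemma orthogonal_opp X Y : orthogonal X (opp Y) = orthogonal X Y.
Proof. by rewrite /orthogonal /opp reverseK eq_sym. Qed.

Lemma circuit_orthogonal_opp Y :
  circuit_orthogonal M (opp Y) = circuit_orthogonal M Y.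
Proof.
rewrite /circuit_orthogonal supp_reverse; congr (_ && _).
by apply: eq_forallb => X; rewrite orthogonal_opp.
Qed.

Lemma cocircuit_opp Y : Y \in cocircuits M -> opp Y \in cocircuits M.
Proof. by rewrite !inE circuit_orthogonal_opp supp_reverse. Qed.

Lemma positive_negN Y e : positive Y -> (Y e == Some false) = false.
Proof. by move=> /eqP Y0; have := in_set0 e; rewrite -Y0 inE. Qed.

(** An elimination of [g] between [Y] and the positive set [W], for signed sets
    orthogonal to circuits.  If no such [U] exists, [farkas] yields a circuit [X]
    with [e] positive, avoiding the negative elements of [Y] other than [g], and
    nonnegative on [W] except at [g].  Orthogonality to [W] forces [X] to be
    negative at [g]; then [X] agrees with [Y] at [g] and is opposite to it
    nowhere, contrary to the orthogonality of [X] and [Y]. *)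
Lemma reduce_negative W Y g e :
    circuit_orthogonal M W -> positive W -> e \in supp W ->
    circuit_orthogonal M Y -> supp Y \subset supp W -> e \notin neg Y ->
    g \in neg Y ->
  exists U, [/\ circuit_orthogonal M U, e \in pos U, supp U \subset supp W :\ g
              & neg U \subset neg Y :\ g].
Proof.
move=> Wo Wp eW Yo YW eY gY.
have [||||U [Uo eU UF UY]] := @farkas _ M (~: supp W :|: [set g]) (neg Y :\ g) e.
- rewrite disjoint_sym disjoints_subset setCU setCK subsetI setDE subsetIr andbT.
  by apply: subset_trans (subsetIl _ _) (subset_trans _ YW); apply: subsetUr.
- by rewrite in_setU in_setC eW in_set1; apply: contraNneq eY => ->.
- by rewrite in_setD1 (negPf eY) andbF.
- move=> X XM XY eX; apply/negP=> XF.
  have posX h : h \in supp W :\ g -> X h != Some false.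
    rewrite in_setD1 => /andP[hg hW]; apply/negP=> hX.
    have := subsetP XF h; rewrite in_setU in_setC in_set1 hW (negPf hg).
    by rewrite inE hX => /(_ isT).
  have WE h : h \in supp W -> W h = Some true.
    by rewrite in_supp => hW; have := positive_negN h Wp; case: (W h) hW => [[]|].
  have Xg : X g = Some false.
    have /forall_inP/(_ X XM) := proj2 (andP Wo); rewrite /orthogonal.
    have -> : (agreement X W == set0) = false.
      apply/negbTE/set0Pn; exists e; rewrite in_agreement WE //.
      by move: eX; rewrite inE => ->.
    rewrite eq_sym eqbF_neg => /set0Pn[h]; rewrite in_agreement oppE.
    case/andP=> hX hW; have hS : h \in supp W.
      by rewrite in_supp; case: (W h) hW.
    move: hX; rewrite WE //= => hX; have [<-|hg] := eqVneq h g; first exact/eqP.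
    by have := posX h; rewrite in_setD1 hg hS hX => /(_ isT).
  have /forall_inP/(_ X XM) := proj2 (andP Yo); rewrite /orthogonal.
  have -> : (agreement X Y == set0) = false.
    apply/negbTE/set0Pn; exists g; rewrite in_agreement Xg.
    by move: gY; rewrite inE => /eqP->.
  rewrite eq_sym eqbF_neg => /set0Pn[h]; rewrite in_agreement oppE.
  case/andP=> /eqP hX hY; have hS : h \in supp Y.
    by rewrite in_supp; case: (Y h) hY.
  have hg : h != g.
    by apply/eqP=> hg; move: gY hX; rewrite inE hg Xg => /eqP->.
  have := posX h; rewrite in_setD1 hg (subsetP YW) // => /(_ isT).
  have hn : h \in neg Y -> False.
    move=> hn; have := disjointFl XY (x := h); rewrite in_setD1 hg hn => /(_ isT).
    by rewrite in_supp hX; case: (Y h) hY.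
  by move: hX hY hn; rewrite inE; case: (Y h) => [[]|] //= ->.
exists U; split=> //; rewrite subsetD1; apply/andP; split.
  apply/subsetP=> h hU; have := disjointFr UF hU; rewrite in_setU in_setC.
  by case: (h \in supp W).
by apply/negP=> gU; have := disjointFr UF gU; rewrite in_setU in_set1 eqxx orbT.
Qed.

(** Take [Z] minimal among the positive orthogonal sets contained in [W] that
    contain [e].  If [Z] properly contained the support of another orthogonal set
    [Y], then [reduce_negative], applied repeatedly to [Y] or to its opposite,
    would remove the negative elements one by one and end with a smaller positive
    set containing [e]. *)
Lemma positive_cocircuit W e :
    circuit_orthogonal M W -> positive W -> e \in supp W ->
  exists2 Z, Z \in cocircuits M &
    [/\ positive Z, e \in supp Z & supp Z \subset supp W].
Proof.
move=> Wo Wp eW; pose ok Z := [&& circuit_orthogonal M Z, positive Z, e \in supp Z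
  & supp Z \subset supp W].
have okW : ok W by apply/and4P.
case: (arg_minnP (fun Z => #|supp Z|) okW) => Z /and4P[Zo Zp eZ ZW] Zmin.
exists Z => //; rewrite inE Zo /=; apply/forall_inP=> Y Yo; apply/negP=> YZ.
(* The last condition ensures that e can be recovered in the next step when it
   is not already in U, because a negative element is then available. *)
pose bad U := [&& circuit_orthogonal M U, supp U \proper supp Z, e \notin neg U
  & (e \in pos U) || (neg U != set0)].
have [U0 badU0] : exists U, bad U.
  have eU U : e \in supp U -> e \notin neg U -> e \in pos U.
    by rewrite in_setU => /orP[] // ->.
  have oppU U : (neg (opp U) = pos U) * (pos (opp U) = neg U).
    by split; apply/setP=> h; rewrite !inE ffunE inE; case: (U h) => [[]|].
  have [en|en] := boolP (e \in neg Y).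
    exists (opp Y); rewrite /bad circuit_orthogonal_opp supp_reverse Yo YZ !oppU.
    by rewrite en andbT; move: en; rewrite !inE => /eqP->.
  have [Y0|Yn] := eqVneq (neg Y) set0; last by exists Y; apply/and4P; rewrite Yn orbT.
  have [ep|ep] := boolP (e \in pos Y); first by exists Y; apply/and4P; rewrite ep.
  exists (opp Y); rewrite /bad circuit_orthogonal_opp supp_reverse Yo YZ !oppU ep.
  by move: (proj1 (andP Yo)); rewrite /supp Y0 setU0 => ->; rewrite orbT.
case: (arg_minnP (fun U => #|neg U|) badU0) => U /and4P[Uo UZ eU Ue] Umin.
have [Un|[g gU]] := set_0Vmem (neg U).
  have /Zmin : ok U.
    rewrite /ok Uo /positive Un eqxx (subset_trans (proper_sub UZ)) //= andbT.
    by move: Ue; rewrite Un eqxx orbF in_setU => ->.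
  by rewrite leqNgt proper_card.
have [V [Vo eV VZ VU]] := reduce_negative Zo Zp eZ Uo (proper_sub UZ) eU gU.
have /Umin : bad V.
  apply/and4P; split=> //; last by rewrite eV.
    apply: sub_proper_trans VZ _; apply: properD1.
    by apply: (subsetP (proper_sub UZ)); rewrite in_setU gU orbT.
  by move: eV; rewrite !inE => /eqP->.
by rewrite leqNgt (leq_ltn_trans (subset_leq_card VU)) // proper_card // properD1.
Qed.

End PositiveCocircuits.

(** * Spans of positive signed sets and absorption *)

Section Spans.
Variable E : finType.
Implicit Types (M N : oriented_matroid E) (K : {set signed_set E}).
Implicit Types (X Y C : signed_set E) (A B U : {set E}) (F : {set {set E}}).

Definition positive_supports K : {set {set E}} :=
  [set supp C | C in K & positive C].

Definition span F U : {set E} := \bigcup_(B in F | B \subset U) B.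

Lemma spanP F U x :
  reflect (exists2 B, B \in F & B \subset U /\ x \in B) (x \in span F U).
Proof.
apply: (iffP bigcupP) => [[B /andP[BF BU] xB]|[B BF [BU xB]]]; exists B => //.
exact/andP.
Qed.

Lemma span_sub F U : span F U \subset U.
Proof. by apply/bigcupsP=> B /andP[]. Qed.

Lemma sub_span F U B : B \in F -> B \subset U -> B \subset span F U.
Proof. by move=> BF BU; apply: bigcup_sup; apply/andP. Qed.

Lemma span_idem F U : span F (span F U) = span F U.
Proof.
apply/eqP; rewrite eqEsubset span_sub; apply/bigcupsP=> B /andP[BF BU].
exact/sub_span/sub_span.
Qed.

Lemma spanS F U U' : U \subset U' -> span F U \subset span F U'.
Proof.
by move=> UU'; apply/bigcupsP=> B /andP[BF BU]; apply: sub_span (subset_trans BU UU').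
Qed.

(** Stated for a family of signed sets, so that one argument serves circuits
    and cocircuits.  The equation on [A] says that [A] is a union of supports of
    positive members of [K]. *)
Definition absorbing K : Prop := forall A C e,
  A = span (positive_supports K) A -> C \in K -> neg C \subset A ->
  e \in pos C :\: A ->
  exists2 B, B \in positive_supports K & B \subset supp C :|: A /\ e \in B.

Definition opp_closed K : Prop := forall X, X \in K -> opp X \in K.

Lemma positive_supp C : positive C -> supp C = pos C.
Proof. by rewrite /supp => /eqP->; rewrite setU0. Qed.

Lemma positive_supportsP K B :
  reflect (exists2 C, C \in K & positive C /\ supp C = B)
          (B \in positive_supports K).
Proof.
apply: (iffP imsetP) => [[C]|[C CK [Cp <-]]]; last by exists C; rewrite // inE CK.
by rewrite inE => /andP[CK Cp] ->; exists C.
Qed.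

Lemma circuits_absorbing M : absorbing (circuits M).
Proof.
move=> A C e AE CM CA eC.
have [|j|Z ZM [eZ Z0 ZS]] := @absorption _ M set0 A _ _ C e CM CA eC.
- exact: sub0set.
- rewrite setD0 AE => /spanP[B /positive_supportsP[D DM [Dp <-]] [DA jD]].
  exists D => //; split; first by rewrite -positive_supp.
    by rewrite (eqP Dp).
  by rewrite -AE.
exists (supp Z); last by split=> //; rewrite in_setU eZ.
by apply/positive_supportsP; exists Z => //; rewrite /positive -subset0.
Qed.

Lemma orthogonal_disjoint X Y : orthogonal X Y -> agreement X (opp Y) = set0 ->
  [disjoint supp X & supp Y].
Proof.
rewrite /orthogonal => + XY; rewrite XY eqxx eqb_id => /eqP XY'.
rewrite disjoints_subset; apply/subsetP=> h; rewrite in_setC !in_supp.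
have := in_set0 h; have := in_set0 h; rewrite -{1}XY -XY' !in_agreement oppE.
by case: (X h) (Y h) => [[]|] [[]|].
Qed.

(** The composition [W] of the positive signed set with support [A] and [D] is
    positive.  It is orthogonal to all circuits: a circuit meeting [A] meets a
    positive cocircuit inside [A], hence has both signs there, and a circuit
    disjoint from [A] sees only [D].  A positive cocircuit through [e] inside [W]
    exists by [positive_cocircuit]. *)
Lemma cocircuits_absorbing M : absorbing (cocircuits M).
Proof.
move=> A D e AE DM DA eD.
have coorth Y : Y \in cocircuits M ->
    (supp Y != set0) /\ forall X, X \in circuits M -> orthogonal X Y.
  by rewrite inE => /andP[/andP[Y0 /forall_inP Yo] _].
pose W : signed_set E := [ffun h => if h \in A then Some true else D h].
have We : e \in supp W.
  by move: eD; rewrite in_setD in_supp ffunE inE => /andP[/negbTE-> /eqP->].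
have Wp : positive W.
  apply/eqP/setP=> h; rewrite !inE ffunE; case: ifP => // hA.
  by apply/negP=> hD; rewrite (subsetP DA) ?inE in hA.
have Wo : circuit_orthogonal M W.
  rewrite /circuit_orthogonal; apply/andP; split; first by apply/set0Pn; exists e.
  apply/forall_inP=> X' X'M; apply/negPn/negP=> /(not_orthogonal X'M).
  case=> X XM [_ [f fX] Xo].
  have XA h : h \in supp X -> h \notin A.
    move=> hX; apply/negP; rewrite AE.
    case/spanP=> B /positive_supportsP[Y YM [Yp <-]] [YA hY].
    have [_ /(_ X XM) Yo] := coorth Y YM.
    suff /(orthogonal_disjoint Yo)/disjointFr/(_ hX) : agreement X (opp Y) = set0.
      by rewrite hY.
    apply/setP=> k; rewrite in_set0 in_agreement oppE; apply/negP=> /andP[kX kY].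
    have kS : k \in supp Y by rewrite in_supp; case: (Y k) kY.
    have := in_set0 k; rewrite -Xo in_agreement oppE ffunE (subsetP YA) //.
    by move: kS kX; rewrite positive_supp // inE => /eqP-> /eqP->.
  have [_ /(_ X XM) Do] := coorth D DM.
  have XE h : X h != None -> W h = D h.
    by rewrite -in_supp ffunE => /XA/negbTE->.
  have /(orthogonal_disjoint Do) XD : agreement X (opp D) = set0.
    apply/setP=> h; rewrite -Xo !in_agreement !oppE.
    have [->|hX] := eqVneq (X h) None; last by rewrite XE.
    by case: (D h) (W h) => [?|] [?|].
  move: fX; rewrite in_agreement => /andP[/eqP fX].
  rewrite -fX => fN; have := disjointFr XD (x := f).
  by rewrite !in_supp -(XE f fN) -fX fN => /(_ isT).
have [Z ZM [Zp eZ ZW]] := positive_cocircuit Wo Wp We.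
exists (supp Z); first by apply/positive_supportsP; exists Z.
split=> //; apply: subset_trans ZW _; apply/subsetP=> h.
by rewrite in_setU !in_supp ffunE; case: (h \in A); rewrite ?orbT ?orbF.
Qed.

End Spans.

(** * Reorientation of families of signed sets *)

Section Reversal.
Variable E : finType.
Implicit Types (M N : oriented_matroid E) (K : {set signed_set E}).
Implicit Types (X Y C : signed_set E) (A B U : {set E}) (F : {set {set E}}).

Definition reverse_all A K : {set signed_set E} := [set reverse A X | X in K].

Definition symdiff A B : {set E} := (A :\: B) :|: (B :\: A).

Lemma mem_reverse_all A K X : (X \in reverse_all A K) = (reverse A X \in K).
Proof.
by rewrite -{1}[X](reverseK A) mem_imset //; apply: inv_inj; apply: reverseK.
Qed.

Lemma reverse_allK A : involutive (reverse_all A).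
Proof. by move=> K; apply/setP=> X; rewrite !mem_reverse_all reverseK. Qed.

Lemma reverse_all0 K : reverse_all set0 K = K.
Proof.
apply/setP=> X; rewrite mem_reverse_all; congr (_ \in K).
by apply/ffunP=> h; rewrite ffunE inE.
Qed.

Lemma reverse_all_symdiff A B K :
  reverse_all (symdiff A B) K = reverse_all B (reverse_all A K).
Proof.
apply/setP=> X; rewrite !mem_reverse_all; congr (_ \in K).
apply/ffunP=> h; rewrite !ffunE !inE.
by case: (h \in A) (h \in B) (X h) => [] [] [[]|].
Qed.

Lemma opp_closed_reverse_all A K : opp_closed K -> opp_closed (reverse_all A K).
Proof. by move=> Ks X; rewrite !mem_reverse_all -opp_reverse; apply: Ks. Qed.

Lemma reverse_allC A K : opp_closed K -> reverse_all (~: A) K = reverse_all A K.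
Proof.
move=> Ks; have oppK X : (opp X \in K) = (X \in K).
  by apply/idP/idP=> /Ks //; rewrite /opp reverseK.
apply/setP=> X; rewrite !mem_reverse_all -[in RHS]oppK; congr (_ \in K).
by apply/ffunP=> h; rewrite oppE !ffunE inE; case: (h \in A) (X h) => [] [[]|].
Qed.

(** Reversing [A] turns a signed set supported in [A] into its opposite. *)
Lemma positive_supports_reverse_in A K B : opp_closed K -> B \subset A ->
  (B \in positive_supports (reverse_all A K)) = (B \in positive_supports K).
Proof.
move=> Ks BA; have sub K' : opp_closed K' -> B \in positive_supports K' ->
    B \in positive_supports (reverse_all A K').
  move=> Ks' /positive_supportsP[C CK [Cp CB]]; apply/positive_supportsP.
  exists C => //; rewrite mem_reverse_all; suff -> : reverse A C = opp C by apply: Ks'.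
  apply/ffunP=> h; rewrite oppE ffunE; case: ifPn => // hA.
  have : h \notin supp C by rewrite CB; apply: contra hA; apply: subsetP.
  by rewrite in_supp negbK => /eqP->.
apply/idP/idP=> [BK|]; last exact: sub.
by rewrite -[K](reverse_allK A); apply: sub => //; apply: opp_closed_reverse_all.
Qed.

Lemma positive_supports_reverse_out A K B : [disjoint B & A] ->
  (B \in positive_supports (reverse_all A K)) = (B \in positive_supports K).
Proof.
move=> BA; have sub K' : B \in positive_supports K' ->
    B \in positive_supports (reverse_all A K').
  move=> /positive_supportsP[C CK [Cp CB]]; apply/positive_supportsP.
  exists C => //; rewrite mem_reverse_all; suff -> : reverse A C = C by [].
  apply/ffunP=> h; rewrite ffunE; case: ifP => // hA.
  by have := disjointFl BA hA; rewrite -CB in_supp; case: (C h).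
by apply/idP/idP=> [/sub|/sub //]; rewrite reverse_allK.
Qed.

(** A member [C] of the reversed family that is positive comes from a member of
    [K] whose negative elements lie in [A].  Its elements outside [A] are
    therefore in positive members of [K] contained in the union of [C] and [A];
    those inside [A] are covered since [A] is a union of positive members of
    [K]. *)
Lemma span_reverse_sub A K U : opp_closed K -> absorbing K ->
    A = span (positive_supports K) A -> A \subset U ->
  span (positive_supports (reverse_all A K)) U \subset
    span (positive_supports K) U.
Proof.
move=> Ks Ka AE AU; apply/subsetP=> x /spanP[B0 /positive_supportsP[C CK]].
rewrite mem_reverse_all in CK; case=> Cp <- {B0} [CU xC].
have [xA|xA] := boolP (x \in A); first by rewrite (subsetP (spanS _ AU)) // -AE.
have [||B BK [BS xB]] := Ka A _ x AE CK.
- apply/subsetP=> h; rewrite inE ffunE; case: ifP => // _.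
  by rewrite positive_negN.
- rewrite in_setD xA; move: xC; rewrite positive_supp // !inE ffunE.
  by rewrite (negPf xA).
apply/spanP; exists B => //; split=> //; apply: subset_trans BS _.
by rewrite supp_reverse subUset CU.
Qed.

(** When [U] is contained in [U'], so is [A], and [span_reverse_sub] applies in
    both directions, [A] being also a union of positive members of the reversed
    family.  When [U'] is contained in [U], the supports that count for [U'] all
    lie in [A], on both sides by [span_reverse_sub] for [U], and inside [A] the
    positive supports of the two families coincide. *)
Lemma span_reverse A K U U' : opp_closed K -> absorbing K ->
    absorbing (reverse_all A K) ->
    A = span (positive_supports K) U -> (U' \subset U) || (U \subset U') ->
  span (positive_supports (reverse_all A K)) U' = span (positive_supports K) U'.
Proof.
move=> Ks Ka Ka' AE UU'; have AI : A = span (positive_supports K) A.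
  by rewrite AE span_idem.
have inA B : B \subset A -> (B \in positive_supports (reverse_all A K)) =
    (B \in positive_supports K) by apply: positive_supports_reverse_in.
have AU : A \subset U by rewrite AE span_sub.
case/orP: UU' => UU'.
  have sub K' B : span (positive_supports K') U \subset A ->
      B \in positive_supports K' -> B \subset U' -> B \subset A.
    move=> KA BK BU; apply: subset_trans KA.
    by apply: sub_span => //; apply: subset_trans UU'.
  apply: eq_bigl => B; apply: andb_id2r => BU.
  apply/idP/idP=> BK; first rewrite -inA //; last rewrite inA //.
    by apply: sub BK BU; rewrite {2}AE; apply: span_reverse_sub.
  by apply: sub BK BU; rewrite -AE.
have AU' := subset_trans AU UU'.
apply/eqP; rewrite eqEsubset span_reverse_sub //=.
rewrite -{1}[K](reverse_allK A); apply: span_reverse_sub => //.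
  exact: opp_closed_reverse_all.
rewrite {1}AI; apply: eq_bigl => B; apply: andb_id2r => BA.
by rewrite inA.
Qed.

Lemma perspective_reorient M N A :
  perspective M N -> perspective (reorient A M) (reorient A N).
Proof.
move=> MN C; rewrite [C \in _]mem_reverse_all => /MN.
rewrite inE => /existsP[F /andP[FN /and3P[Fc /eqP Fp /eqP Fn]]].
rewrite inE; apply/existsP; exists (reverse_all A F); apply/andP; split.
  by apply/subsetP=> X; rewrite mem_reverse_all [X \in _]mem_reverse_all; apply: subsetP.
have sgn e s : (reverse A C e == Some s) = [exists X in F, X e == Some s].
  case: s; [move/setP/(_ e): (Fp) | move/setP/(_ e): (Fn)]; rewrite inE => ->.
  - by apply/bigcupP/exists_inP=> -[X XF hX]; exists X => //; move: hX; rewrite inE.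
  - by apply/bigcupP/exists_inP=> -[X XF hX]; exists X => //; move: hX; rewrite inE.
have CE e : C e = if e \in A then omap negb (reverse A C e) else reverse A C e.
  by rewrite -{1}[C](reverseK A) ffunE.
have sgn' e s : (C e == Some s) = [exists X in reverse_all A F, X e == Some s].
  transitivity (reverse A C e == Some (s (+) (e \in A))).
    by rewrite ffunE; case: (e \in A) (C e) s => [] [[]|] [].
  rewrite sgn; apply/exists_inP/exists_inP=> -[X XF /eqP hX].
    exists (reverse A X); first by rewrite mem_reverse_all reverseK.
    by rewrite ffunE hX; case: (e \in A) s {hX} => [] [].
  exists (reverse A X); first by rewrite -mem_reverse_all.
  by rewrite ffunE hX; case: (e \in A) s {hX} => [] [].
apply/and3P; split.
- apply/forall_inP=> X; rewrite mem_reverse_all => XF.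
  apply/forall_inP=> Y; rewrite mem_reverse_all => YF.
  have /forall_inP/(_ _ YF)/forall_inP XY := forall_inP Fc _ XF.
  apply/forall_inP=> e; have := XY e; rewrite !in_setI !supp_reverse !ffunE.
  by case: ifP => // _ h /h; case: (X e) (Y e) => [[]|] [[]|].
- apply/eqP/setP=> e; rewrite inE sgn'.
  by apply/exists_inP/bigcupP=> -[X XF hX]; exists X => //; move: hX; rewrite inE.
- apply/eqP/setP=> e; rewrite inE sgn'.
  by apply/exists_inP/bigcupP=> -[X XF hX]; exists X => //; move: hX; rewrite inE.
Qed.

(** A positive circuit of [M] is a union of positive circuits of [N], and
    a positive circuit and a positive cocircuit of [N] that met would agree
    somewhere without being opposite anywhere. *)
Lemma perspective_disjoint M N B D : perspective M N ->
  B \in positive_supports (circuits M) ->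
  D \in positive_supports (cocircuits N) -> [disjoint B & D].
Proof.
move=> MN /positive_supportsP[C /MN CN [Cp <-]] /positive_supportsP[Y YN [Yp <-]].
move: CN; rewrite inE => /existsP[F /andP[FN /and3P[_ /eqP Fp /eqP Fn]]].
rewrite disjoints_subset; apply/subsetP=> x; rewrite positive_supp // Fp.
case/bigcupP=> X XF xX; rewrite in_setC.
have Xp : positive X.
  by rewrite /positive -subset0 -(eqP Cp) Fn; apply: bigcup_sup.
move: YN; rewrite inE => /andP[/andP[_ /forall_inP Yo] _].
have := Yo X (subsetP FN X XF) => /orthogonal_disjoint XY.
have /XY/disjointFr -> // : agreement X (opp Y) = set0; last by rewrite in_setU xX.
apply/setP=> h; rewrite in_agreement oppE inE.
have := positive_negN h Xp; have := positive_negN h Yp.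
by case: (X h) (Y h) => [[]|] [[]|].
Qed.

Lemma circuits_opp_closed M : opp_closed (circuits M).
Proof. by move=> X; apply: circuit_opp. Qed.

Lemma cocircuits_opp_closed M : opp_closed (cocircuits M).
Proof. by move=> X; apply: cocircuit_opp. Qed.

End Reversal.

(** * Reorientations preserving the spans *)

Section Stability.
Variables (d : Order.disp_t) (E : finOrderType d).
Implicit Types (M N : oriented_matroid E) (A B U : {set E}) (t : option E).

(** The value [None] is a threshold above all elements, matching [onth] past
    the end of a sequence. *)
Definition tail t : {set E} := if t is Some g then [set x | (g <= x)%O] else set0.

Lemma tail_total t t' : (tail t' \subset tail t) || (tail t \subset tail t').
Proof.
case: t t' => [t|] [t'|]; rewrite ?sub0set ?orbT //=.
by case/orP: (le_total t t') => tt'; apply/orP; [left | right];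
  apply/subsetP=> x; rewrite !inE; apply: le_trans.
Qed.

Definition cycle_span M t := span (positive_supports (circuits M)) (tail t).
Definition cocycle_span N t := span (positive_supports (cocircuits N)) (tail t).

Definition span_preserving M N A : Prop := forall t,
  cycle_span (reorient A M) t = cycle_span M t /\
  cocycle_span (reorient A N) t = cocycle_span N t.

Lemma cycle_spanE A M t : cycle_span (reorient A M) t =
  span (positive_supports (reverse_all A (circuits M))) (tail t).
Proof. by []. Qed.

Lemma cocycle_spanE A N t : cocycle_span (reorient A N) t =
  span (positive_supports (reverse_all A (cocircuits N))) (tail t).
Proof. by rewrite /cocycle_span cocircuits_reorient. Qed.

Lemma absorbing_circuits_reorient M A : absorbing (reverse_all A (circuits M)).
Proof. exact: (@circuits_absorbing _ (reorient A M)). Qed.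

Lemma absorbing_cocircuits_reorient M A : absorbing (reverse_all A (cocircuits M)).
Proof. by rewrite /reverse_all -cocircuits_reorient; apply: cocircuits_absorbing. Qed.

(** For circuits this is [span_reverse].  The positive cocircuits of [N] are
    disjoint from [A], and so are those of the reoriented [N], because [A] is
    still a union of positive circuits in the reoriented perspective. *)
Lemma cycle_span_preserving M N t :
  perspective M N -> span_preserving M N (cycle_span M t).
Proof.
move=> MN t'; set A := cycle_span M t.
have AE t1 : cycle_span (reorient A M) t1 = cycle_span M t1.
  rewrite cycle_spanE; apply: (@span_reverse _ _ _ (tail t)) => //.
  - exact: circuits_opp_closed.
  - exact: circuits_absorbing.
  - exact: absorbing_circuits_reorient.
  - exact: tail_total.
split=> //; rewrite cocycle_spanE; apply: eq_bigl => B; congr (_ && _).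
have disj M' N' : perspective M' N' -> A = cycle_span M' t ->
    B \in positive_supports (cocircuits N') -> [disjoint B & A].
  move=> MN' A' BN; rewrite disjoint_sym disjoints_subset A'.
  apply/bigcupsP=> C /andP[CM _]; rewrite -disjoints_subset.
  exact: (perspective_disjoint MN').
apply/idP/idP=> BN.
  rewrite -(@positive_supports_reverse_out _ A) //.
  apply: (disj (reorient A M) (reorient A N)) => //.
    exact: perspective_reorient.
  by rewrite cocircuits_reorient.
by rewrite positive_supports_reverse_out //; apply: (disj M N).
Qed.

Lemma cocycle_span_preserving M N t :
  perspective M N -> span_preserving M N (cocycle_span N t).
Proof.
move=> MN t'; set A := cocycle_span N t.
have AE t1 : cocycle_span (reorient A N) t1 = cocycle_span N t1.
  rewrite cocycle_spanE; apply: (@span_reverse _ _ _ (tail t)) => //.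
  - exact: cocircuits_opp_closed.
  - exact: cocircuits_absorbing.
  - exact: absorbing_cocircuits_reorient.
  - exact: tail_total.
split=> //; rewrite cycle_spanE; apply: eq_bigl => B; congr (_ && _).
have disj M' N' : perspective M' N' -> A = cocycle_span N' t ->
    B \in positive_supports (circuits M') -> [disjoint B & A].
  move=> MN' A' BM; rewrite disjoint_sym disjoints_subset A'.
  apply/bigcupsP=> C /andP[CN _]; rewrite -disjoints_subset disjoint_sym.
  exact: (perspective_disjoint MN').
apply/idP/idP=> BM.
  rewrite -(@positive_supports_reverse_out _ A) //.
  by apply: (disj (reorient A M) (reorient A N)) => //; apply: perspective_reorient.
by rewrite positive_supports_reverse_out //; apply: (disj M N).
Qed.

(** The sets G_k and H_k, with thresholds not tied to the active elements, so
    that being a flag member is visibly invariant when the spans are. *)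
Definition flag M N A : Prop :=
  exists t, A = cycle_span M t \/ A = ~: cocycle_span N t.

Lemma flag_preserving M N A : perspective M N -> flag M N A ->
  span_preserving M N A.
Proof.
move=> MN [t [->|->]]; first exact: cycle_span_preserving.
move=> t'; have [h1 h2] := cocycle_span_preserving t MN t'.
rewrite cycle_spanE cocycle_spanE !reverse_allC -?cycle_spanE -?cocycle_spanE //.
  exact: cocircuits_opp_closed.
exact: circuits_opp_closed.
Qed.

(** After the reorientation of [A], the set [B] is still a flag member, so
    [flag_preserving] applies to the reoriented perspective. *)
Lemma span_preserving_symdiff M N A B : perspective M N ->
  span_preserving M N A -> flag M N B -> span_preserving M N (symdiff A B).
Proof.
move=> MN hA [t Bt] t'.
have [hM hN] := hA t; have [hM' hN'] := hA t'.
have : flag (reorient A M) (reorient A N) B by exists t; rewrite hM hN.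
move/(flag_preserving (perspective_reorient (A := A) MN))/(_ t') => [].
rewrite !cycle_spanE !cocycle_spanE cocircuits_reorient !reverse_all_symdiff.
by rewrite -hM' -hN' cocycle_spanE.
Qed.

(** * The active partition as a function of the spans *)

Lemma is_minE B m : is_min B m = (m \in B) && (B \subset tail (Some m)).
Proof.
congr (_ && _); apply/forall_inP/subsetP=> h e eB; first by rewrite inE h.
by have := h e eB; rewrite inE.
Qed.

(** The nonemptiness of [B] provides its minimum. *)
Lemma exists_min B g : B != set0 ->
  [exists m, is_min B m && (g <= m)%O] = (B \subset tail (Some g)).
Proof.
move=> /set0Pn[x xB]; apply/existsP/idP=> [[m /andP[mB gm]]|Bg].
  move: mB; rewrite is_minE => /andP[_ /subset_trans]; apply.
  by apply/subsetP=> y; rewrite !inE; apply: le_trans.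
case: (@arg_minP _ _ _ x [in B] id xB) => m mB mmin; exists m.
rewrite is_minE mB /=; apply/andP; split.
  by apply/subsetP=> y yB; rewrite inE mmin.
by have := subsetP Bg m mB; rewrite inE.
Qed.

Lemma flagG_span M k :
  flagG M k = cycle_span M (onth (increasing (active_elements M)) k).
Proof.
rewrite /flagG /cycle_span; case: onth => [g|]; last first.
  by apply/esym/eqP; rewrite -subset0; apply: span_sub.
apply: eq_bigl => B; apply: andb_id2l => /positive_supportsP[C CM [_ <-]].
by rewrite exists_min //; apply: circuit_neq0 CM.
Qed.

Lemma flagH_span N k :
  flagH N k = ~: cocycle_span N (onth (increasing (dual_active_elements N)) k).
Proof.
rewrite /flagH /cocycle_span; case: onth => [g|]; last first.
  rewrite -setC0; congr (~: _).
  by apply/esym/eqP; rewrite -subset0; apply: span_sub.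
congr (~: _).
apply: eq_bigl => B; apply: andb_id2l => /positive_supportsP[C CN [_ <-]].
by rewrite exists_min //; move: CN; rewrite inE => /andP[/andP[]].
Qed.

Lemma active_elementsE M :
  active_elements M = [set g | g \in cycle_span M (Some g)].
Proof.
apply/setP=> g; rewrite !inE; apply/exists_inP/spanP=> -[B BM].
  by rewrite is_minE => /andP[gB Bg]; exists B.
by case=> Bg gB; exists B => //; rewrite is_minE gB.
Qed.

Lemma dual_active_elementsE N :
  dual_active_elements N = [set g | g \in cocycle_span N (Some g)].
Proof.
apply/setP=> g; rewrite !inE; apply/exists_inP/spanP=> -[B BM].
  by rewrite is_minE => /andP[gB Bg]; exists B.
by case=> Bg gB; exists B => //; rewrite is_minE gB.
Qed.

Lemma tail_onth B i j : (i <= j)%N ->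
  tail (onth (increasing B) j) \subset tail (onth (increasing B) i).
Proof.
move=> ij; case E1: (onth _ j) => [h|]; last by rewrite sub0set.
have jB : (j < size (increasing B))%N by rewrite -onthTE E1.
have iB := leq_ltn_trans ij jB.
case E2: (onth _ i) => [g|]; last by rewrite -onthTE E2 in iB.
have := sorted_leq_nth le_trans le_refl h (sort_le_sorted (enum B)) i j iB jB ij.
rewrite (onth_nth h _ _ _ E1) (onth_nth h _ _ _ E2) => gh.
by apply/subsetP=> x; rewrite !inE; apply: le_trans.
Qed.

Lemma cyclic_partsP M p : reflect
  (exists2 k, (k < #|active_elements M|)%N & p = flagG M k :\: flagG M k.+1)
  (p \in cyclic_parts M).
Proof.
apply: (iffP imsetP) => [[k _ ->]|[k kM ->]]; first by exists k.
by exists (Ordinal kM).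
Qed.

Lemma acyclic_partsP N p : reflect
  (exists2 k, (k < #|dual_active_elements N|)%N
            & p = flagH N k.+1 :\: flagH N k)
  (p \in acyclic_parts N).
Proof.
apply: (iffP imsetP) => [[k _ ->]|[k kN ->]]; first by exists k.
by exists (Ordinal kN).
Qed.

(** The active elements, hence their number and enumeration, and all members of
    the flags are functions of the spans. *)
Lemma span_preserving_parts M N A : span_preserving M N A ->
  [/\ cyclic_parts (reorient A M) = cyclic_parts M,
      acyclic_parts (reorient A N) = acyclic_parts N
    & hybrid_part (reorient A M) (reorient A N) = hybrid_part M N].
Proof.
move=> hA.
have aE : active_elements (reorient A M) = active_elements M.
  by rewrite !active_elementsE; apply/setP=> g; rewrite !inE (proj1 (hA _)).
have dE : dual_active_elements (reorient A N) = dual_active_elements N.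
  by rewrite !dual_active_elementsE; apply/setP=> g; rewrite !inE (proj2 (hA _)).
have GE k : flagG (reorient A M) k = flagG M k.
  by rewrite !flagG_span aE (proj1 (hA _)).
have HE k : flagH (reorient A N) k = flagH N k.
  by rewrite !flagH_span dE (proj2 (hA _)).
split; last by rewrite /hybrid_part GE HE.
  apply/setP=> p; apply/cyclic_partsP/cyclic_partsP; rewrite aE;
    by case=> k kM ->; exists k; rewrite ?GE.
apply/setP=> p; apply/acyclic_partsP/acyclic_partsP; rewrite dE;
  by case=> k kN ->; exists k; rewrite ?HE.
Qed.

(** * The parts as differences of nested flag members *)

Lemma flagG_anti M i j : (i <= j)%N -> flagG M j \subset flagG M i.
Proof. by move=> ij; rewrite !flagG_span; apply/spanS/tail_onth. Qed.

Lemma flagH_mono N i j : (i <= j)%N -> flagH N i \subset flagH N j.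
Proof. by move=> ij; rewrite !flagH_span setCS; apply/spanS/tail_onth. Qed.

Lemma flagG0_sub_flagH0 M N : perspective M N -> flagG M 0 \subset flagH N 0.
Proof.
move=> MN; rewrite flagG_span flagH_span; apply/bigcupsP=> B /andP[BM _].
rewrite -disjoints_subset disjoint_sym disjoints_subset.
apply/bigcupsP=> D /andP[DN _]; rewrite -disjoints_subset disjoint_sym.
exact: (perspective_disjoint MN).
Qed.

Lemma disjoint_layers (T : finType) (f : nat -> {set T}) i j :
    (forall m n, (m <= n)%N -> f m \subset f n) -> i != j ->
  [disjoint f i.+1 :\: f i & f j.+1 :\: f j].
Proof.
move=> fm; wlog ij : i j / (i < j)%N => [hw|_].
  have [ij|ji|->] := ltngtP i j; rewrite ?eqxx // => _; last rewrite disjoint_sym.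
    by apply: hw; rewrite ?neq_ltn ?ij.
  by apply: hw; rewrite ?neq_ltn ?ji.
rewrite disjoints_subset; apply/subsetP=> x; rewrite in_setC !in_setD.
by case/andP=> _ /(subsetP (fm _ _ ij)) ->.
Qed.

Lemma part_layer M N p : perspective M N -> p \in active_partition M N ->
  exists F G : {set E}, [/\ flag M N F, flag M N G, F \subset G & p = G :\: F].
Proof.
move=> MN; have flG k : flag M N (flagG M k).
  by rewrite flagG_span; eexists; left.
have flH k : flag M N (flagH N k) by rewrite flagH_span; eexists; right.
case/setUP=> [/setUP[/cyclic_partsP[k _ ->]|/set1P->]|/acyclic_partsP[k _ ->]].
- by exists (flagG M k.+1), (flagG M k); split=> //; apply: flagG_anti.
- by exists (flagG M 0), (flagH N 0); split=> //; apply: flagG0_sub_flagH0.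
by exists (flagH N k), (flagH N k.+1); split=> //; apply: flagH_mono.
Qed.

Lemma parts_disjoint M N p q : perspective M N ->
    p \in active_partition M N -> q \in active_partition M N -> p != q ->
  [disjoint p & q].
Proof.
move=> MN.
have GH := flagG0_sub_flagH0 MN.
have cyc r : r \in cyclic_parts M -> r \subset flagG M 0.
  case/cyclic_partsP=> k _ ->; apply: subset_trans (subsetDl _ _) _.
  exact: flagG_anti.
have acyc r : r \in acyclic_parts N -> r \subset ~: flagH N 0.
  case/acyclic_partsP=> k _ ->; rewrite setDE; apply: subset_trans (subsetIr _ _) _.
  by rewrite setCS; apply: flagH_mono.
have hyb : hybrid_part M N \subset flagH N 0 /\ [disjoint hybrid_part M N & flagG M 0].
  by rewrite subsetDl disjoints_subset /hybrid_part setDE subsetIr.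
have cyc_acyc r s : r \in cyclic_parts M -> s \in acyclic_parts N -> [disjoint r & s].
  move=> /cyc rG /acyc sH; rewrite disjoints_subset (subset_trans rG) //.
  by rewrite (subset_trans GH) // -setCS setCK.
have cyc_hyb r : r \in cyclic_parts M -> [disjoint r & hybrid_part M N].
  by move=> /cyc rG; rewrite disjoint_sym (disjointWr rG) //; case: hyb.
have acyc_hyb r : r \in acyclic_parts N -> [disjoint r & hybrid_part M N].
  move=> /acyc rG; rewrite disjoints_subset (subset_trans rG) // setCS.
  by case: hyb.
case/setUP=> [/setUP[pc|/set1P->]|pa]; case/setUP=> [/setUP[qc|/set1P->]|qa].
- move: pc qc => /cyclic_partsP[i _ ->] /cyclic_partsP[j _ ->] neq.
  have := @disjoint_layers _ (fun k => ~: flagG M k) i j.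
  rewrite !setDE !setCK setIC [_ :&: flagG M j]setIC; apply.
    by move=> m n mn; rewrite setCS; apply: flagG_anti.
  by apply: contraNneq neq => ->.
- by move=> _; apply: cyc_hyb.
- by move=> _; apply: cyc_acyc.
- by move=> _; rewrite disjoint_sym; apply: cyc_hyb.
- by rewrite eqxx.
- by move=> _; rewrite disjoint_sym; apply: acyc_hyb.
- by move=> _; rewrite disjoint_sym; apply: cyc_acyc.
- by move=> _; apply: acyc_hyb.
move: pa qa => /acyclic_partsP[i _ ->] /acyclic_partsP[j _ ->] neq.
apply: (@disjoint_layers _ (flagH N)) => [m n|]; first exact: flagH_mono.
by apply: contraNneq neq => ->.
Qed.

(** By induction on the number of parts: a part [G :\: F] disjoint from a union
    [A] of other parts is added to it by two symmetric differences. *)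
Lemma union_of_parts_preserving M N (S : {set {set E}}) : perspective M N ->
  S \subset active_partition M N -> span_preserving M N (cover S).
Proof.
move=> MN; have [n] := ubnP #|S|; elim: n S => // n IHn S Sn SP.
have [->|[p pS]] := set_0Vmem S.
  by move=> t; rewrite /cover big_set0 cycle_spanE cocycle_spanE !reverse_all0.
have [F [G [Ff Gf FG pE]]] := part_layer MN (subsetP SP p pS).
pose A := cover (S :\ p).
have Ap : [disjoint A & p].
  rewrite disjoints_subset; apply/bigcupsP=> q; rewrite in_setD1 => /andP[qp qS].
  rewrite -disjoints_subset; apply: (parts_disjoint MN) => //.
    exact: (subsetP SP).
  exact: (subsetP SP).
have -> : cover S = symdiff (symdiff A F) G.
  have -> : cover S = p :|: A.
    by rewrite -{1}(setD1K pS) /cover big_setU1 ?setD11.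
  apply/setP=> x; have := disjointFr Ap (x := x); have := subsetP FG x.
  rewrite pE !inE.
  case: (x \in F) (x \in G) (x \in A) => [] [] [] //= h1 h2;
    by [have := h1 isT | have := h2 isT].
apply: span_preserving_symdiff => //; apply: span_preserving_symdiff => //.
apply: IHn; last by apply: subset_trans SP; apply: subD1set.
by move: Sn; rewrite (cardsD1 p) pS.
Qed.

End Stability.

Theorem proposition2 (d : Order.disp_t) (E : finOrderType d)
    (M N : oriented_matroid E) (MN : perspective M N) (A : {set E})
    (HA : exists2 S : {set {set E}},
      S \subset active_partition M N & A = cover S) :
  perspective (reorient A M) (reorient A N) /\
  [/\ cyclic_parts (reorient A M) = cyclic_parts M,
      acyclic_parts (reorient A N) = acyclic_parts N
    & hybrid_part (reorient A M) (reorient A N) = hybrid_part M N].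
Proof.
split; first exact: perspective_reorient.
case: HA => S SP ->; apply: span_preserving_parts.
exact: union_of_parts_preserving.
Qed.
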